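(* Let $r\ge 2$ and let $\mathcal{F}$ be a family of $r$-uniform hypergraphs with Turán density $\pi(\mathcal{F})>1/2$. Let $\varepsilon$ and $\sigma$ be sufficiently small numbers such that $\varepsilon\gg\sigma>0$. For each $n$, let $\mathcal{H}_n$ denote the set of all $\mathcal{F}$-free $r$-uniform hypergraphs on $n$ vertices with minimum degree greater than $\bigl(\pi(\mathcal{F})/(r-1)!-\varepsilon\bigr)n^{r-1}$. Suppose that there exists $N>0$ such that for every $n>N$, \[ \Bigl|\mathrm{ex}_r(n,\mathcal{F})-\mathrm{ex}_r(n-1,\mathcal{F})-\frac{\pi(\mathcal{F})}{(r-1)!}n^{r-1}\Bigr|\le \sigma n^{r-1} \] and \[ \Bigl|q(\mathcal{H}_n)-2r\,\frac{\mathrm{ex}_r(n,\mathcal{F})}{n}\Bigr|\le \sigma n^{r-2}. \] Then there exists $n_0>0$ such that for every $\mathcal{F}$-free $r$-uniform hypergraph $\mathcal{G}$ on $n\ge n_0$ vertices, $q(\mathcal{G})\le q(\mathcal{H}_n)$. Moreover, equality holds only if $\mathcal{G}\in\mathcal{H}_n$.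
   Context: An $r$-uniform hypergraph ($r$-graph) $\mathcal{H}=(V,E)$ has $E$ a collection of $r$-subsets of the finite set $V$. For a family $\mathcal{F}$ of $r$-graphs, $\mathcal{H}$ is $\mathcal{F}$-free if it contains no member of $\mathcal{F}$ as a subgraph. $\mathrm{ex}_r(n,\mathcal{F})$ is the maximum number of edges of an $\mathcal{F}$-free $r$-graph on $n$ vertices, and $\pi(\mathcal{F})=\lim_{n\to\infty}\mathrm{ex}_r(n,\mathcal{F})/\binom{n}{r}$. The degree $d(v)$ of a vertex is the number of edges containing it; the minimum degree is $\delta(\mathcal{H})=\min_v d(v)$. For an order-$r$, dimension-$n$ tensor $\mathcal{T}=(t_{i_1\cdots i_r})$ and $\mathbf{x}\in\mathbb{C}^n$, $(\mathcal{T}\mathbf{x})_i=\sum_{i_2,\dots,i_r}t_{ii_2\cdots i_r}x_{i_2}\cdots x_{i_r}$; $\lambda\in\mathbb{C}$ is an eigenvalue if $\mathcal{T}\mathbf{x}=\lambda\mathbf{x}^{[r-1]}$ for some nonzero $\mathbf{x}$, where $\mathbf{x}^{[r-1]}=(x_1^{r-1},\dots,x_n^{r-1})$; the spectral radius is the maximum modulus of the eigenvalues. The adjacency tensor $\mathcal{A}(\mathcal{H})$ of an $r$-graph on $n$ vertices has entry $a_{i_1\cdots i_r}=1/(r-1)!$ if $\{v_{i_1},\dots,v_{i_r}\}\in E(\mathcal{H})$ and $0$ otherwise; $\mathcal{D}(\mathcal{H})$ is the diagonal tensor with diagonal entries $d(v_i)$; the signless Laplacian tensor is $\mathcal{Q}(\mathcal{H})=\mathcal{D}(\mathcal{H})+\mathcal{A}(\mathcal{H})$,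 and $q(\mathcal{H})$ denotes its spectral radius. For a family $\mathfrak{H}$ of $r$-graphs, $q(\mathfrak{H})=\max\{q(\mathcal{H}):\mathcal{H}\in\mathfrak{H}\}$. *)

(* Defs.v *)
From mathcomp Require Import all_boot all_order all_algebra.
From mathcomp Require Import all_classical all_reals all_analysis.
From mathcomp Require Import complex.

Set Implicit Arguments.
Unset Strict Implicit.
Unset Printing Implicit Defensive.

Import Order.TTheory GRing.Theory Num.Theory.
Import numFieldNormedType.Exports.

Local Open Scope classical_set_scope.
Local Open Scope ring_scope.

Section Hypergraphs.

(* A hypergraph on the vertex set 'I_n is identified with its edge set. *)
Definition hypergraph (n : nat) := {set {set 'I_n}}.

Definition uniform (r n : nat) (E : hypergraph n) : bool :=
  [forall e in E, #|e| == r].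

Definition degree (n : nat) (E : hypergraph n) (v : 'I_n) : nat :=
  #|[set e in E | v \in e]|.

(* The default value #|E| bounds every degree, so it plays no role once
   0 < n. *)
Definition min_degree (n : nat) (E : hypergraph n) : nat :=
  \big[minn/#|E|]_(v < n) degree E v.

(* The injection f is defined on all of 'I_m: the isolated vertices of K also
   need room in E. *)
Definition contains (m n : nat) (K : hypergraph m) (E : hypergraph n) : Prop :=
  exists2 f : 'I_m -> 'I_n, injective f & forall e, e \in K -> f @: e \in E.

(* A possibly infinite family. Only the isomorphism types of its members
   matter, so vertex sets of the form 'I_m suffice. *)
Definition hypergraph_family := forall m : nat, set (hypergraph m).

Definition uniform_family (r : nat) (F : hypergraph_family) : Prop :=
  forall (m : nat) (K : hypergraph m), F m K -> uniform r K.

Definition family_free (F : hypergraph_family) (n : nat) (E : hypergraph n) :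
    Prop :=
  forall (m : nat) (K : hypergraph m), F m K -> ~ contains K E.

Definition turan_number (r : nat) (F : hypergraph_family) (n : nat) : nat :=
  (\max_(E : hypergraph n | uniform r E && `[< family_free F E >]) #|E|)%N.

Definition turan_density (R : realType) (r : nat) (F : hypergraph_family) : R :=
  lim (((turan_number r F n)%:R / 'C(n, r)%:R : R) @[n --> \oo]).

End Hypergraphs.

Section Tensors.
Variables (R : realType) (r n : nat).

Definition tensor := r.-tuple 'I_n -> R[i].

(* (T x)_i sums over the index tuples (i_1, ..., i_r) with i_1 = i. *)
Definition tensor_app (T : tensor) (x : 'cV[R[i]]_n) : 'cV[R[i]]_n :=
  \col_i \sum_(t : r.-tuple 'I_n | ohead t == Some i)
            T t * \prod_(j <- behead t) x j 0.

Definition tensor_eigenvalue (T : tensor) (l : R[i]) : Prop :=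
  exists2 x : 'cV[R[i]]_n,
    x != 0 & tensor_app T x = l *: (\col_i (x i 0 ^+ r.-1)).

(* For 0 < n and 1 < r, the eigenvalues are the roots of a nonconstant
   polynomial, so this supremum is a maximum. *)
Definition spectral_radius (T : tensor) : R :=
  sup [set ComplexField.Normc.normc l | l in tensor_eigenvalue T].

Definition adjacency_tensor (E : hypergraph n) : tensor :=
  fun t => if [set j in t]%SET \in E then ((r.-1)`!%:R)^-1 else 0.

Definition degree_tensor (E : hypergraph n) : tensor :=
  fun t => \sum_(i < n | t == [tuple of nseq r i]) (degree E i)%:R.

Definition signless_laplacian (E : hypergraph n) : tensor :=
  fun t => degree_tensor E t + adjacency_tensor E t.

Definition q_radius (E : hypergraph n) : R :=
  spectral_radius (signless_laplacian E).

(* q_radius is nonnegative, so the default 0 only matters when S is empty. *)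
Definition q_radius_max (S : {set hypergraph n}) : R :=
  \big[Num.max/0]_(E in S) q_radius E.

Definition dense_free (F : hypergraph_family) (eps : R) : {set hypergraph n} :=
  [set E : hypergraph n | [&& uniform r E, `[< family_free F E >]
     & (turan_density R r F / (r.-1)`!%:R - eps) * n%:R ^+ r.-1
         < (min_degree E)%:R]]%SET.

End Tensors.

(* Main.v *)
(* The spectral radius q(E) of the signless Laplacian is the maximum of the form
   lap_form over nonnegative x with sum_i x_i^r = 1, attained at an eigenvector.
   Let u minimise such an eigenvector x on n vertices and put M = C(n-1, r-1),
   K = C(n-2, r-2).  Comparing lap_form before and after the deletion of u, and
   using the eigenvector equation at a vertex v of minimum degree d to bound
   x_u from above, one gets
     q(E - u) >= q - K - K (q - M) / (q - 2d + M).
   With Q = q / M and D = d / M this says that Q increases by at least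
   (Q - 1)(Q - 2D) / (3n).  Near-extremality gives Q close to 2 pi > 1, and
   outside the dense class D is below pi by a multiple of eps, so the gain is at
   least c / n, whereas 2 ex(n) / C(n, r) varies by only O(sigma / n).  Hence
   Q - 2 ex(n) / C(n, r) grows at each deletion, which keeps the smaller graphs
   outside the dense class as well; since the harmonic series diverges, this
   contradicts Q <= 2. *)
Require Import Defs.
From mathcomp Require Import all_boot all_order all_algebra.
From mathcomp Require Import all_classical all_reals all_analysis.
From mathcomp Require Import complex ring lra zify.
Import Order.TTheory GRing.Theory Num.Theory.
Import numFieldNormedType.Exports.
Local Open Scope ring_scope.

Set Implicit Arguments.
Unset Strict Implicit.
Unset Printing Implicit Defensive.

(** * Edge weights and vertex deletion *)

(** Coordinate [i] of the adjacency tensor applied to [x], by [sum_adjacency]. The ring is general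
    because both real and complex vectors occur. *)
Definition link_sum (K : comNzRingType) (n : nat) (E : hypergraph n)
    (x : 'I_n -> K) (i : 'I_n) : K :=
  \sum_(e in E | i \in e) \prod_(j in e :\ i) x j.

(** The degree-[r] form of the signless Laplacian, grouped by edges; [lap_form_link] regroups it by
    vertices. *)
Definition lap_form (K : comNzRingType) (r n : nat) (E : hypergraph n)
    (x : 'I_n -> K) : K :=
  \sum_(e in E) (\sum_(i in e) x i ^+ r + r%:R * \prod_(i in e) x i).

Section Form.
Variables (K : comNzRingType) (r n : nat) (E : hypergraph n).
Implicit Types (x : 'I_n -> K) (i : 'I_n).

Lemma uniformP (e : {set 'I_n}) : uniform r E -> e \in E -> #|e| = r.
Proof. by move=> /forallP /(_ e) /implyP h /h /eqP. Qed.

Lemma mul_link_sum x i :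
  x i * link_sum E x i = \sum_(e in E | i \in e) \prod_(j in e) x j.
Proof.
rewrite /link_sum mulr_sumr; apply: eq_bigr => e /andP[_ ie].
by rewrite [RHS](big_setD1 i).
Qed.

Lemma sum_degree (f : 'I_n -> K) :
  \sum_(e in E) \sum_(i in e) f i = \sum_i (degree E i)%:R * f i.
Proof.
rewrite (exchange_big_dep predT) //=; apply: eq_bigr => i _.
rewrite sumr_const mulr_natl; congr (_ *+ _).
by apply: eq_card => e; rewrite !inE.
Qed.

Lemma sum_mul_link x : uniform r E ->
  \sum_i x i * link_sum E x i = \sum_(e in E) r%:R * \prod_(i in e) x i.
Proof.
move=> uE; under eq_bigr do rewrite mul_link_sum.
rewrite (exchange_big_dep (mem E)) /=; last by move=> i e _ /andP[].
apply: eq_bigr => e eE; under eq_bigl => i do rewrite eE /=.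
by rewrite sumr_const (uniformP uE eE) mulr_natl.
Qed.

Lemma lap_form_link x : uniform r E ->
  lap_form r E x =
    \sum_i ((degree E i)%:R * x i ^+ r + x i * link_sum E x i).
Proof.
move=> uE; rewrite /lap_form !big_split /= -(sum_mul_link _ uE).
by congr (_ + _); rewrite sum_degree.
Qed.

End Form.

(** * Degree and codegree counts *)

Section Counting.
Variables (n r : nat) (E : hypergraph n).

(** Removing [S] is injective on the edges above [S] and lands in the sets of size [r - #|S|]
    outside [S]. *)
Lemma card_superset_edges (S : {set 'I_n}) : uniform r E ->
  (#|[set e in E | S \subset e]| <= 'C(n - #|S|, r - #|S|))%N.
Proof.
move=> uE; have -> : (n - #|S| = #|~: S|)%N by have := cardsC S; rewrite card_ord; lia.
rewrite -cards_draws.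
have inj : {in [set e in E | S \subset e] &, injective (fun e => e :\: S)}.
  move=> e f; rewrite !inE => /andP[_ Se] /andP[_ Sf] ef.
  by rewrite -(finset.setID e S) -(finset.setID f S) ef (finset.setIidPr Se) (finset.setIidPr Sf).
rewrite -(card_in_imset inj) subset_leq_card //.
apply/fintype.subsetP => _ /imsetP[e + ->]; rewrite !inE => /andP[eE Se].
by rewrite finset.subsetDr -(uniformP uE eE) cardsD (finset.setIidPr Se) eqxx.
Qed.

Lemma degree_le i : uniform r E -> (degree E i <= 'C(n.-1, r.-1))%N.
Proof.
move=> /(card_superset_edges [set i]); rewrite cards1 !subn1.
by congr (_ <= _)%N; apply: eq_card => e; rewrite !inE finset.sub1set.
Qed.

Lemma codegree_le i j : i != j -> uniform r E ->
  (#|[set e in E | (i \in e) && (j \in e)]| <= 'C(n - 2, r - 2))%N.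
Proof.
move=> ij /(card_superset_edges [set i; j]); rewrite cards2 ij.
by congr (_ <= _)%N; apply: eq_card => e; rewrite !inE finset.subUset !finset.sub1set.
Qed.

Lemma min_degree_attained : (0 < n)%N ->
  exists v, (degree E v <= min_degree E)%N.
Proof.
case: n E => // m F _.
case: (arg_minnP (P := predT) (degree F) (erefl : predT (ord0 : 'I_m.+1))) => v _ vmin.
exists v; rewrite /min_degree.
apply: (big_ind (fun d => degree F v <= d)%N).
(* The default value [#|E|] of the minimum is at least every degree. *)
- by apply/subset_leq_card/fintype.subsetP => e; rewrite inE => /andP[].
- by move=> a b; rewrite leq_min => -> ->.
- by move=> i _; apply: vmin.
Qed.

End Counting.

(** The arithmetic-geometric mean inequality for the powers [x i ^+ #|A|], followed by extraction of
    the [#|A|]-th root. *)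
Lemma AM_GM_power (R : realFieldType) (I : finType) (A : {set I}) (x : I -> R) :
  (0 < #|A|)%N -> (forall i, 0 <= x i) ->
  #|A|%:R * \prod_(i in A) x i <= \sum_(i in A) x i ^+ #|A|.
Proof.
move=> A0 x0.
have c0 : 0 < #|A|%:R :> R by rewrite ltr0n.
have /leifP := @leif_AGM R I A (fun i => x i ^+ #|A|) (fun i _ => exprn_ge0 _ (x0 i)).
rewrite prodrXl => H.
have {H} : (\prod_(i in A) x i) ^+ #|A| <= ((\sum_(i in A) x i ^+ #|A|) / #|A|%:R) ^+ #|A|.
  by case: ifP H => _ => [/eqP -> //|/ltW].
rewrite ler_pXn2r ?nnegrE ?A0 //; last 2 first.
- exact: prodr_ge0.
- by rewrite divr_ge0 // ?sumr_ge0 // => i _; rewrite exprn_ge0.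
by rewrite ler_pdivlMr // mulrC.
Qed.

(** On each edge AM-GM bounds the product term by the power term, so the form is at most twice the
    degree-weighted sum of powers. *)
Lemma lap_form_le (R : realFieldType) (r n : nat) (E : hypergraph n)
    (x : 'I_n -> R) :
  (0 < r)%N -> uniform r E -> (forall i, 0 <= x i) ->
  lap_form r E x <= 2 * 'C(n.-1, r.-1)%:R * \sum_i x i ^+ r.
Proof.
move=> r0 uE x0.
have H : lap_form r E x <= \sum_(e in E) 2 * \sum_(i in e) x i ^+ r.
  apply: ler_sum => e eE; rewrite [leRHS]mulr_natl mulr2n lerD2l.
  by rewrite -(uniformP uE eE) AM_GM_power // (uniformP uE eE).
apply: (le_trans H); rewrite -mulr_sumr -mulrA ler_wpM2l //.
rewrite sum_degree mulr_sumr; apply: ler_sum => i _.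
by rewrite ler_wpM2r ?exprn_ge0 // ler_nat degree_le.
Qed.

(** * Deletion of a vertex *)

Definition delete_vertex (n : nat) (u : 'I_n.+1) (E : hypergraph n.+1) :
    hypergraph n :=
  [set e : {set 'I_n} | lift u @: e \in E].

Section Delete.
Variables (n : nat) (u : 'I_n.+1) (E : hypergraph n.+1).

Lemma delete_vertex_uniform r : uniform r E -> uniform r (delete_vertex u E).
Proof.
move=> uE; apply/forallP => e; apply/implyP; rewrite inE => /(uniformP uE) <-.
by rewrite card_imset //; apply: lift_inj.
Qed.

Lemma delete_vertex_free F : family_free F E -> family_free F (delete_vertex u E).
Proof.
move=> fE m K FK [f f_inj fP]; apply: (fE m K FK).
exists (lift u \o f); first exact: inj_comp (@lift_inj _ u) f_inj.
by move=> e /fP; rewrite inE -imset_comp.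
Qed.

Lemma sum_delete_vertex (V : nmodType) (g : {set 'I_n.+1} -> V) :
  \sum_(e in delete_vertex u E) g (lift u @: e) = \sum_(e in E | u \notin e) g e.
Proof.
rewrite (reindex_onto (fun e : {set 'I_n} => lift u @: e)
                      (fun e : {set 'I_n.+1} => lift u @^-1: e)) /=.
  apply: eq_bigl => e; rewrite inE.
  have -> : lift u @^-1: (lift u @: e) == e.
    by apply/eqP/setP => i; rewrite inE mem_imset //; apply: lift_inj.
  have -> : u \notin [set lift u x | x in e].
    by apply/imsetP => -[i _ /eqP]; rewrite (negPf (neq_lift _ _)).
  by rewrite !andbT.
move=> e /andP[_ ue]; apply/setP => i; apply/imsetP/idP => [[j + ->]|ie].
  by rewrite inE.
case: (unliftP u i) => [j ij|iu]; last by rewrite -iu ie in ue.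
by exists j; rewrite // inE -ij.
Qed.

Lemma lap_form_delete (K : comNzRingType) r (x : 'I_n.+1 -> K) :
  lap_form r E x = lap_form r (delete_vertex u E) (x \o lift u)
  + (\sum_(e in E | u \in e) \sum_(i in e) x i ^+ r
     + r%:R * (x u * link_sum E x u)).
Proof.
rewrite mul_link_sum mulr_sumr -big_split /=.
rewrite /lap_form (bigID (fun e : {set 'I_n.+1} => u \in e)) /= addrC.
congr (_ + _); rewrite -sum_delete_vertex; apply: eq_bigr => e _.
have linj : {in e &, injective (lift u)} by move=> i j _ _; apply: lift_inj.
by rewrite !(big_imset _ linj).
Qed.

End Delete.

(** * Deletion of the lightest vertex of an eigenvector *)

Section Removal.
Variables (R : realFieldType) (k n : nat) (E : hypergraph n.+1).
Let r := k.+2.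
Let M : R := 'C(n, k.+1)%:R.
Let K : R := 'C(n.-1, k)%:R.

Variables (x : 'I_n.+1 -> R) (q : R).
Hypothesis n_gt0 : (0 < n)%N.
Hypothesis uE : uniform r E.
Hypothesis x_ge0 : forall i, 0 <= x i.
Hypothesis x_norm : \sum_i x i ^+ r = 1.
Hypothesis x_eigen :
  forall i, (q - (degree E i)%:R) * x i ^+ k.+1 = link_sum E x i.

Variable u : 'I_n.+1.
Hypothesis u_min : forall i, x u <= x i.
Let a := x u ^+ r.

Let a_ge0 : 0 <= a. Proof. exact: exprn_ge0. Qed.
Let a_min i : a <= x i ^+ r. Proof. by rewrite lerXn2r ?nnegrE. Qed.

Lemma lap_form_eigen : lap_form r E x = q.
Proof.
rewrite (lap_form_link _ uE) -[RHS]mulr1 -[in RHS]x_norm mulr_sumr; apply: eq_bigr => i _.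
by rewrite -x_eigen /r [x i ^+ k.+2]exprS; ring.
Qed.

Lemma min_weight_le : n.+1%:R * a <= 1.
Proof.
rewrite -[leRHS]x_norm; apply: le_trans (ler_sum _ (fun i _ => a_min i)).
by rewrite sumr_const card_ord mulr_natl.
Qed.

Let bin_absorb : n%:R * K = k.+1%:R * M.
Proof. by rewrite -!natrM mul_bin_diag. Qed.

(* Subtracting the minimal weight [a] leaves nonnegative weights, for which the
   codegrees may be replaced by their upper bound [K]. *)
Lemma link_weight_le i :
  \sum_(e in E | i \in e) \sum_(j in e :\ i) x j ^+ r
    <= K * (1 - a) - k.+1%:R * (M - (degree E i)%:R) * a.
Proof.
have -> : \sum_(e in E | i \in e) \sum_(j in e :\ i) x j ^+ r
    = \sum_(e in E | i \in e) \sum_(j in e :\ i) (x j ^+ r - a)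
      + k.+1%:R * (degree E i)%:R * a.
  have -> : k.+1%:R * (degree E i)%:R * a
      = \sum_(e in E | i \in e) \sum_(j in e :\ i) a.
    rewrite (eq_bigr (fun=> a *+ k.+1)); last first.
      move=> e /andP[eE ie]; rewrite sumr_const; congr (_ *+ _).
      by have := uniformP uE eE; rewrite (cardsD1 i) ie => -[].
    rewrite sumr_const -mulrnA -natrM mulr_natl; congr (_ *+ (_ * _))%N.
    by apply: eq_card => e; rewrite !inE.
  rewrite -big_split /=; apply: eq_bigr => e _.
  by rewrite -big_split /=; apply: eq_bigr => j _; rewrite subrK.
(* The identity [n * K = k.+1 * M] turns this bound, with the weights [a] restored, into the
   claim. *)
suff : \sum_(e in E | i \in e) \sum_(j in e :\ i) (x j ^+ r - a)
    <= K * (1 - n.+1%:R * a).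
  have : n%:R * K * a = k.+1%:R * M * a by rewrite bin_absorb.
  rewrite -[n.+1%:R]natr1; lra.
rewrite (exchange_big_dep predT) //=.
(* After the exchange of sums, [j] occurs once for each edge through [i] and [j]: at most [K] times,
   and never for [j = i]. *)
apply: (@le_trans _ _ (\sum_j K * (x j ^+ r - a))).
  apply: ler_sum => j _.
  have ja : 0 <= x j ^+ r - a by rewrite subr_ge0.
  rewrite sumr_const -mulr_natl ler_wpM2r //.
  have [<-|ij] := eqVneq i j.
    rewrite eq_card0 ?ler0n // => e.
    by apply/negP => /andP[_]; rewrite !inE eqxx.
  rewrite ler_nat -subn1 -[(n - 1)%N]/(n.+1 - 2)%N.
  have := codegree_le ij uE; rewrite [(r - 2)%N]subn2 /=.
  apply: leq_trans; apply: subset_leq_card; apply/fintype.subsetP => e.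
  by rewrite !inE => /andP[/andP[-> ->]]; rewrite !inE => /andP[_ ->].
by rewrite -mulr_sumr sumrB x_norm sumr_const card_ord mulr_natl.
Qed.

(** The edges at [u] carry [a] once each, the weights of the link, and [r (q - d(u)) a] by the
    eigenvector equation. With [link_weight_le] the degree of [u] cancels from the total; the
    remaining entries have weight [1 - a]. *)
Lemma removal_loss q' :
  (forall y, (forall i, 0 <= y i) ->
     lap_form r (delete_vertex u E) y <= q' * \sum_i y i ^+ r) ->
  q * (1 - a) - k.+1%:R * (q - M) * a - K * (1 - a) <= q' * (1 - a).
Proof.
move=> /(_ (x \o lift u) (fun i => x_ge0 _)).
have -> : \sum_i (x \o lift u) i ^+ r = 1 - a.
  by rewrite -x_norm (bigD1_ord u) //= addrAC subrr add0r.
apply: le_trans.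
have := lap_form_delete u E r x; rewrite lap_form_eigen => /eqP.
rewrite -subr_eq => /eqP <-.
rewrite -x_eigen (eq_bigr (fun e => a + \sum_(j in e :\ u) x j ^+ r)); last first.
  by move=> e /andP[_ ue]; rewrite (big_setD1 u).
rewrite big_split /= sumr_const.
have -> : #|[pred e | (e \in E) && (u \in e)]| = degree E u.
  by apply: eq_card => e; rewrite !inE.
have := link_weight_le u; set s := \sum_(e in E | _) _ => s_le.
have -> : x u * ((q - (degree E u)%:R) * x u ^+ k.+1) = (q - (degree E u)%:R) * a.
  by rewrite /a /r [x u ^+ k.+2]exprS; ring.
rewrite -mulr_natl /r -[k.+2%:R]natr1; nra.
Qed.

(* Scaled so that the minimal entry is 1, all entries satisfy
   [z_j ^ (r-1) <= z_j ^ r], and AM-GM bounds the link sum at [v] by the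
   weight of the link. *)
Lemma min_weight_bound v : (degree E v)%:R <= q ->
  k.+1%:R * (q - 2 * (degree E v)%:R + M) * a <= K * (1 - a).
Proof.
move=> dq.
(* The upper bound is [link_weight_le] at [v]; what remains is a lower bound for the weight of the
   link. *)
suff : k.+1%:R * (q - (degree E v)%:R) * a <=
    \sum_(e in E | v \in e) \sum_(j in e :\ v) x j ^+ r.
  by have := link_weight_le v; nra.
have : k.+1%:R * ((q - (degree E v)%:R) * a) <=
    k.+1%:R * (x u * ((q - (degree E v)%:R) * x v ^+ k.+1)).
  rewrite ler_wpM2l // [leRHS]mulrCA ler_wpM2l ?subr_ge0 // /a /r.
  rewrite [x u ^+ k.+2]exprS.
  by rewrite ler_wpM2l // lerXn2r ?nnegrE.
rewrite mulrA => /le_trans; apply; rewrite x_eigen /link_sum 2!mulr_sumr.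
apply: ler_sum => e /andP[eE ve].
have ce : #|e :\ v| = k.+1.
  by have := uniformP uE eE; rewrite (cardsD1 v) ve => -[].
rewrite mulrCA; apply: (@le_trans _ _ (x u * \sum_(j in e :\ v) x j ^+ k.+1)).
  by rewrite ler_wpM2l // -ce AM_GM_power // ce.
rewrite mulr_sumr; apply: ler_sum => j _.
by rewrite /r [x j ^+ k.+2]exprS ler_wpM2r ?exprn_ge0.
Qed.

(** The upper bound on [a] from [min_weight_bound] is inserted into [removal_loss], and the factor
    [1 - a] is divided out. *)
Lemma removal_bound q' v : M <= q -> 0 < q - 2 * (degree E v)%:R + M ->
  (forall y, (forall i, 0 <= y i) ->
     lap_form r (delete_vertex u E) y <= q' * \sum_i y i ^+ r) ->
  q - K - K * (q - M) / (q - 2 * (degree E v)%:R + M) <= q'.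
Proof.
move=> Mq den /removal_loss loss.
have dM : (degree E v)%:R <= M by rewrite ler_nat (degree_le v uE).
have := min_weight_bound (le_trans dM Mq).
(* At least two vertices are present, so the minimal weight is at most one half. *)
have a1 : 0 < 1 - a.
  have := min_weight_le; have : 1 <= n%:R :> R by rewrite ler1n.
  rewrite -[n.+1%:R]natr1; have := a_ge0; nra.
set D := _ + M in den *; rewrite mulrAC -ler_pdivlMr // => bound.
rewrite -(ler_pM2r a1); apply: le_trans loss.
have := ler_wpM2l (_ : 0 <= q - M) bound; rewrite subr_ge0 => /(_ Mq).
have -> : (q - M) * (K * (1 - a) / D) = K * (q - M) / D * (1 - a) by ring.
set t := K * (q - M) / D; lra.
Qed.

End Removal.

(** * Perron theory of the signless Laplacian tensor *)

Section TensorAction.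
Variables (R : realType) (k n : nat) (E : hypergraph n).
Let r := k.+2.
Hypothesis uE : uniform r E.

Lemma big_tuple_cons (V : nmodType) (i : 'I_n) (G : r.-tuple 'I_n -> V) :
  \sum_(t : r.-tuple 'I_n | ohead t == Some i) G t
    = \sum_(t : k.+1.-tuple 'I_n) G [tuple of i :: t].
Proof.
rewrite (reindex_onto (fun t : k.+1.-tuple 'I_n => [tuple of i :: t])
                      (fun t : r.-tuple 'I_n => [tuple of behead t])) /=.
  apply: eq_bigl => t; rewrite eqxx /=; symmetry.
  suff -> : [tuple of behead (i :: t)] = t by rewrite eqxx.
  exact: val_inj.
move=> t; rewrite (tuple_eta t) /= => /eqP[<-].
by apply: val_inj.
Qed.

(** An edge has [r] elements, so the [r - 1] entries of [t] must be distinct and exhaust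
    [e :\ i]. *)
Lemma link_tupleE (e : {set 'I_n}) (i : 'I_n) (t : k.+1.-tuple 'I_n) :
  i \in e -> #|e| = r ->
  (i |: [set j in t]%SET == e) = all (mem (e :\ i)) t && uniq t.
Proof.
move=> ie; rewrite (cardsD1 i) ie add1n => -[ce].
have tk : (#|[set j in t]%SET| <= k.+1)%N.
  by rewrite cardsE (leq_trans (card_size t)) ?size_tuple.
apply/eqP/andP => [et|[/allP te ut]].
  have sub : e :\ i \subset [set j in t]%SET.
    apply/fintype.subsetP => j; rewrite -et !inE => /andP[ji].
    by rewrite (negPf ji).
  have /eqP te : e :\ i == [set j in t]%SET by rewrite eqEcard sub ce.
  split; first by apply/allP => j jt; rewrite /= te inE.
  by apply/card_uniqP; rewrite size_tuple -cardsE -te ce.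
have /eqP -> : [set j in t]%SET == e :\ i.
  rewrite eqEcard ce cardsE (card_uniqP ut) size_tuple leqnn andbT.
  by apply/fintype.subsetP => j; rewrite inE => /te.
by rewrite finset.setD1K.
Qed.

Lemma sum_link_tuples (V : nmodType) (e : {set 'I_n}) (i : 'I_n) (c : V) :
  i \in e -> #|e| = r ->
  \sum_(t : k.+1.-tuple 'I_n | i |: [set j in t]%SET == e) c = c *+ k.+1`!.
Proof.
move=> ie ce; rewrite sumr_const; congr (_ *+ _).
have de : #|e :\ i| = k.+1 by move: ce; rewrite (cardsD1 i) ie => -[].
rewrite -ffactnn -[in X in X ^_ _]de -card_uniq_tuples.
by apply: eq_card => t; rewrite [in RHS]inE -(link_tupleE _ ie ce).
Qed.

(** Each edge through [i] arises from the [(r-1)!] orderings of its other vertices, which cancels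
    the normalisation of the tensor. *)
Lemma sum_adjacency (x : 'I_n -> R[i]) (i : 'I_n) :
  \sum_(t : r.-tuple 'I_n | ohead t == Some i)
    adjacency_tensor R E t * \prod_(j <- behead t) x j = link_sum E x i.
Proof.
rewrite big_tuple_cons /=.
have E1 (t : k.+1.-tuple 'I_n) :
    [set j in [tuple of i :: t]]%SET = i |: [set j in t]%SET.
  by apply/setP => j; rewrite !inE.
rewrite (eq_bigr (fun t : k.+1.-tuple 'I_n =>
    if i |: [set j in t]%SET \in E then
      (k.+1`!%:R)^-1 * \prod_(j in (i |: [set j in t]%SET) :\ i) x j
    else 0)); last first.
  move=> t _; rewrite /adjacency_tensor E1; case: ifP; rewrite ?mul0r // => tE.
  have := link_tupleE t (setU11 i [set j in t]%SET) (uniformP uE tE).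
  rewrite eqxx => /esym/andP[/allP te ut]; congr (_ * _).
  rewrite big_uniq //; apply: eq_bigl => j.
  by apply/idP/idP => [/te //|]; rewrite !inE => /andP[/negPf ->].
(* The tuples are grouped by the edge that they span together with [i]. *)
rewrite -big_mkcond /= (partition_big (fun t : k.+1.-tuple 'I_n =>
  i |: [set j in t]%SET) (mem E)) //= /link_sum [RHS]big_mkcondr /=.
apply: eq_bigr => e eE; case: ifP => [ie|/negP ie]; last first.
  by apply: big1 => t /andP[_ /eqP te]; case: ie; rewrite -te setU11.
rewrite (eq_big (fun t : k.+1.-tuple 'I_n => i |: [set j in t]%SET == e)
  (fun=> (k.+1`!%:R)^-1 * \prod_(j in e :\ i) x j)); first last.
- by move=> t /andP[_ /eqP ->].
- by move=> t /=; case: eqP => [->|]; rewrite ?eE // andbF.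
rewrite (sum_link_tuples _ ie (uniformP uE eE)) -mulrnAl -mulr_natr mulVf ?mul1r //.
Qed.

Lemma sum_degree_tensor (x : 'I_n -> R[i]) (i : 'I_n) :
  \sum_(t : r.-tuple 'I_n | ohead t == Some i)
    degree_tensor R E t * \prod_(j <- behead t) x j
  = (degree E i)%:R * x i ^+ k.+1.
Proof.
rewrite (bigD1 [tuple of nseq r i]) /= ?eqxx //.
(* The degree tensor vanishes off constant tuples, and the constant tuple starting with [i] has been
   split off. *)
rewrite [X in _ + X]big1 ?addr0; last first.
  move=> t /andP[/eqP ti tn]; rewrite /degree_tensor big1 ?mul0r // => j /eqP tj.
  by move: tn ti; rewrite tj /= => /negP tn [ji]; case: tn; rewrite ji.
congr (_ * _); last first.
  by rewrite -[i :: nseq k i]/(nseq k.+1 i) big_nseq iter_mulr_1.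
rewrite /degree_tensor (bigD1 i) ?eqxx //= big1 ?addr0 // => j /andP[/eqP ij ji].
by move: ij => /(congr1 (ohead \o val)) [/eqP]; rewrite eq_sym (negPf ji).
Qed.

Lemma tensor_app_laplacian (x : 'cV[R[i]]_n) (i : 'I_n) :
  tensor_app (signless_laplacian R (r := r) E) x i 0
    = (degree E i)%:R * x i 0 ^+ k.+1 + link_sum E (fun j => x j 0) i.
Proof.
rewrite mxE /signless_laplacian; under eq_bigr do rewrite mulrDl.
by rewrite big_split /= sum_adjacency (sum_degree_tensor (fun j => x j 0)).
Qed.

End TensorAction.

(** * Maximisation of the form *)

Lemma continuous_big (R : realType) (T : topologicalType) (I : Type)
    (op : R -> R -> R) (idx : R) (s : seq I) (P : pred I) (f : I -> T -> R) :
  (forall g h : T -> R, continuous g -> continuous h ->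
     continuous (fun v => op (g v) (h v))) ->
  (forall i, continuous (f i)) ->
  continuous (fun v => \big[op/idx]_(i <- s | P i) f i v).
Proof.
move=> opC fC; elim: s => [|i s IH].
  by under eq_fun do rewrite big_nil; apply: cst_continuous.
under eq_fun do rewrite big_cons.
by case: (P i) => //; apply: opC.
Qed.

(** The first-order condition for one coordinate of a maximiser. For [s > 0] the difference of the
    two sides has an interior minimum at [s]; for [s = 0] a small positive [t] violates the
    inequality unless [b = 0]. *)
Lemma stationary_power (R : realType) (k : nat) (A b s : R) :
  0 <= s -> 0 <= b ->
  (forall t, 0 <= t -> k.+2%:R * b * (t - s) <= A * (t ^+ k.+2 - s ^+ k.+2)) ->
  A * s ^+ k.+1 = b.
Proof.
rewrite le_eqVlt => /orP[/eqP <- b0 H|s0 b0 H]; last first.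
  pose f : R -> R := A *: (id ^+ k.+2 : R -> R) - (k.+2%:R * b) *: (id : R -> R).
  have fE t : f t = A * t ^+ k.+2 - (k.+2%:R * b) * t.
    by rewrite /f !fctE.
  have df (t : R) : is_derive t 1 f (A * (k.+2%:R * t ^+ k.+1) - k.+2%:R * b).
    apply: is_derive_eq.
    by rewrite /GRing.scale /= !mulr1.
  have : is_derive s 1 f 0.
    apply: (@derive1_at_min _ f 0 (s *+ 2)).
    - by rewrite mulrn_wge0 // ltW.
    - by move=> u _; have [] := df u.
    - by rewrite in_itv /= s0 mulr2n ltrDr.
    - move=> u; rewrite in_itv /= => /andP[t0' _].
      by have := H u (ltW t0'); rewrite !fE; lra.
  move=> d0; have := @derive_val _ _ _ _ _ _ _ d0.
  rewrite (@derive_val _ _ _ _ _ _ _ (df s)) => /eqP.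
  by rewrite mulrCA -mulrBr mulf_eq0 pnatr_eq0 /= subr_eq0 => /eqP.
rewrite expr0n /= mulr0; apply/eqP; rewrite eq_sym eq_le b0 andbT leNgt.
apply/negP => b_gt0.
(* This [t] is at most 1 and satisfies [|A| t < b], which contradicts the assumed inequality. *)
set t := b / (b + `|A| + 1).
have den : 0 < b + `|A| + 1 by have := normr_ge0 A; lra.
have t0 : 0 < t by rewrite divr_gt0.
have t1 : t <= 1 by rewrite ler_pdivrMr // mul1r; have := normr_ge0 A; lra.
have := H t (ltW t0); rewrite subr0 expr0n /= subr0 exprSr [leRHS]mulrA ler_pM2r //.
apply/negP; rewrite -ltNge.
have tk : A * t ^+ k.+1 <= `|A| * t.
  apply: (@le_trans _ _ (`|A| * t ^+ k.+1)).
    by rewrite ler_wpM2r ?ler_norm // exprn_ge0 ?ltW.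
  by rewrite ler_wpM2l // exprS ler_piMr ?(ltW t0) // exprn_ile1 ?(ltW t0).
apply: (le_lt_trans tk).
have : `|A| * t < b.
  rewrite /t mulrCA gtr_pMr // ltr_pdivrMr // mul1r; lra.
move/lt_le_trans; apply; by rewrite ler_peMl // ler1n.
Qed.

Section Maximizer.
Variables (R : realType) (k n : nat) (E : hypergraph n).
Let r := k.+2.
Implicit Types x y : 'I_n -> R.

Lemma lap_form_perturb x i t :
  let y := fun j => if j == i then t else x j in
  lap_form r E y - lap_form r E x
    = (degree E i)%:R * (t ^+ r - x i ^+ r)
      + r%:R * (t - x i) * link_sum E x i.
Proof.
move=> y; rewrite /lap_form -sumrB (bigID (fun e : {set 'I_n} => i \in e)) /=.
have yE (e : {set 'I_n}) j : j \in e :\ i -> y j = x j.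
  by rewrite !inE /y => /andP[/negPf ->].
rewrite [X in _ + X]big1 ?addr0; last first.
  move=> e /andP[eE ie].
  have ye j : j \in e -> y j = x j.
    by rewrite /y; case: eqP => // -> ie'; rewrite ie' in ie.
  rewrite (eq_bigr (fun j => x j ^+ r)); last by move=> j /ye ->.
  by rewrite (eq_bigr x) ?subrr // => j /ye ->.
rewrite (eq_bigr (fun e : {set 'I_n} => (t ^+ r - x i ^+ r)
  + r%:R * (t - x i) * \prod_(j in e :\ i) x j)); last first.
  move=> e /andP[eE ie].
  rewrite 2!(big_setD1 i ie (F := fun j => _ j ^+ r)) /=.
  rewrite 2!(big_setD1 i ie) /= (eq_bigr (fun j => x j ^+ r)); last first.
    by move=> j /yE ->.
  rewrite [X in y i * X](eq_bigr x); last by move=> j /yE ->.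
  by rewrite /y eqxx; ring.
rewrite big_split /= sumr_const -mulr_sumr [(degree E i)%:R * _]mulr_natl.
congr (_ + _); congr (_ *+ _).
by apply: eq_card => e; rewrite !inE.
Qed.

Lemma lap_formZ c x : uniform r E ->
  lap_form r E (fun i => c * x i) = c ^+ r * lap_form r E x.
Proof.
move=> uE; rewrite /lap_form mulr_sumr; apply: eq_bigr => e eE.
rewrite mulrDr mulr_sumr; congr (_ + _).
  by apply: eq_bigr => i _; rewrite exprMn.
by rewrite big_split /= prodr_const (uniformP uE eE) mulrCA.
Qed.

(** The nonnegative vectors with unit sum of [r]-th powers form a closed subset of a compact cube,
    where the continuous form attains its maximum; homogeneity extends the bound to all nonnegative
    vectors. *)
Lemma lap_form_maximizer : (0 < n)%N -> uniform r E ->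
  exists x, [/\ forall i, 0 <= x i, \sum_i x i ^+ r = 1 &
    forall y, (forall i, 0 <= y i) ->
      lap_form r E y <= lap_form r E x * \sum_i y i ^+ r].
Proof.
move=> n0 uE.
pose S : set 'rV[R]_n := [set v | \sum_i v ord0 i ^+ r = 1]%classic.
pose B : set 'rV[R]_n :=
  [set v | forall i, (`[0 : R, 1]%classic : set R) (v ord0 i)]%classic.
have coordC i : continuous (fun v : 'rV[R]_n => v ord0 i) by apply: coord_continuous.
have sumC (g h : 'rV[R]_n -> R) : continuous g -> continuous h ->
    continuous (fun v => g v + h v) by move=> gC hC v; exact: continuousD (gC v) (hC v).
have prdC (g h : 'rV[R]_n -> R) : continuous g -> continuous h ->
    continuous (fun v => g v * h v) by move=> gC hC v; exact: continuousM (gC v) (hC v).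
have powC i : continuous (fun v : 'rV[R]_n => v ord0 i ^+ r).
  move=> v; apply: (@continuous_comp _ _ _ (fun w : 'rV[R]_n => w ord0 i)
    (fun t : R => t ^+ r) v (coordC i v)).
  exact: exprn_continuous.
have B_compact : compact B.
  apply: (@rV_compact R n (fun=> `[0 : R, 1]%classic)) => _.
  exact: segment_compact.
have S_closed : closed S.
  apply: (@preimage_closed _ _ (fun v : 'rV[R]_n => \sum_i v ord0 i ^+ r)
    [set t | t = 1]%classic _ (@closed_eq R 1)).
  by move=> v _; apply: continuous_big.
have fC : continuous (fun v : 'rV[R]_n => lap_form r E (v ord0)).
  apply: continuous_big => // e; apply: (sumC); first by apply: continuous_big.
  apply: (prdC); first exact: cst_continuous.
  by apply: continuous_big.
have [|||c cSB cmax] := @EVT_max_rV R n (fun v => lap_form r E (v ord0)) (B `&` S)%classic.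
- exists (\row_i (i == Ordinal n0)%:R); split.
    by move=> i /=; rewrite mxE in_itv /= ler0n /=; case: eqP.
  rewrite /S /= (bigD1 (Ordinal n0)) //= mxE eqxx expr1n big1 ?addr0 // => i.
  by move=> /negPf i0; rewrite mxE i0 expr0n.
- exact: compact_closedI.
- exact: continuous_subspaceT.
move: cSB; rewrite inE => -[cB cS].
have c0 i : 0 <= c ord0 i by have := cB i; rewrite /= in_itv /= => /andP[].
exists (c ord0); split => // y y0.
set s := \sum_i y i ^+ r.
have s0 : 0 <= s by apply: sumr_ge0 => i _; apply: exprn_ge0.
(* If [s = 0] then [y] vanishes, and so does the form because edges are nonempty. *)
have [s_gt0|] := ltP 0 s; last first.
  move=> s_le0; have y_eq0 i : y i = 0.
    have : s = 0 by apply/le_anti; rewrite s_le0.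
    move/eqP; rewrite psumr_eq0; last by move=> j _; apply: exprn_ge0.
    by move=> /allP /(_ i (mem_index_enum _)); rewrite expf_eq0 /= => /eqP.
  rewrite (_ : s = 0); last by apply/le_anti; rewrite s_le0.
  rewrite mulr0 [X in X <= _]big1 // => e eE.
  rewrite big1 ?add0r; last by move=> i _; rewrite y_eq0 expr0n.
  have : (0 < #|e|)%N by rewrite (uniformP uE eE).
  by case/card_gt0P => i ie; rewrite (bigD1 i ie) /= y_eq0 mul0r mulr0.
(* The factor [s^(-1/r)] normalises [y]. *)
pose c' := (s `^ (r%:R^-1))^-1.
have c'r : c' ^+ r = s^-1.
  by rewrite /c' exprVn -powR_mulrn ?powR_ge0 // -powRrM mulVf ?powRr1 // pnatr_eq0.
have c'0 : 0 <= c' by rewrite invr_ge0 powR_ge0.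
have norm1 : \sum_i (c' * y i) ^+ r = 1.
  under eq_bigr do rewrite exprMn.
  by rewrite -mulr_sumr c'r mulVf // gt_eqF.
have := cmax (\row_i (c' * y i)).
have -> : (\row_i (c' * y i)) ord0 = (fun i => c' * y i).
  by apply/funext => i; rewrite mxE.
rewrite lap_formZ // c'r mulrC ler_pdivrMr //; apply.
rewrite inE; split; last first.
  by rewrite /S /=; under eq_bigr do rewrite mxE.
move=> i /=; rewrite mxE in_itv /= mulr_ge0 //=.
rewrite -(@ler_pXn2r _ r) ?nnegrE ?mulr_ge0 // expr1n -norm1.
rewrite (bigD1 i) //= lerDl; apply: sumr_ge0 => j _.
by rewrite exprn_ge0 // mulr_ge0.
Qed.

(** Varying one coordinate yields exactly the inequality required by [stationary_power], with
    [A = q - degree E i]; zero coordinates are covered too. *)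
Lemma maximizer_eigen x q i :
  (forall i, 0 <= x i) -> \sum_i x i ^+ r = 1 -> lap_form r E x = q ->
  (forall y, (forall i, 0 <= y i) -> lap_form r E y <= q * \sum_i y i ^+ r) ->
  (q - (degree E i)%:R) * x i ^+ k.+1 = link_sum E x i.
Proof.
move=> x0 x1 xq qmax; apply: stationary_power => //.
  by apply: sumr_ge0 => e _; apply: prodr_ge0.
move=> t t0; pose y j := if j == i then t else x j.
have /qmax : forall j, 0 <= y j by move=> j; rewrite /y; case: eqP.
have := lap_form_perturb x i t; rewrite -/y xq => /eqP.
rewrite subr_eq => /eqP ->.
have -> : \sum_j y j ^+ r = 1 + (t ^+ r - x i ^+ r).
  rewrite -x1 (bigD1 i) // [in RHS](bigD1 i) //= {1}/y eqxx.
  rewrite (eq_bigr (fun j => x j ^+ r)); last by move=> j /negPf ji; rewrite /y ji.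
  by ring.
by rewrite /r; nra.
Qed.

End Maximizer.

(** * The spectral radius as the maximum of the form *)

Section Perron.
Variables (R : realType) (k n : nat) (E : hypergraph n).
Let r := k.+2.
Hypothesis uE : uniform r E.

Local Notation normc := (@ComplexField.Normc.normc R).

Lemma normc_prod (I : Type) (s : seq I) (P : pred I) (f : I -> R[i]) :
  normc (\prod_(i <- s | P i) f i) = \prod_(i <- s | P i) normc (f i).
Proof.
apply: (big_morph normc); first exact: ComplexField.Normc.normcM.
exact: ComplexField.Normc.normc1.
Qed.

Lemma normcX (z : R[i]) m : normc (z ^+ m) = normc z ^+ m.
Proof.
elim: m => [|m IH]; first by rewrite !expr0 ComplexField.Normc.normc1.
by rewrite !exprS ComplexField.Normc.normcM IH.
Qed.

Lemma normc_sum (I : Type) (s : seq I) (P : pred I) (f : I -> R[i]) :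
  normc (\sum_(i <- s | P i) f i) <= \sum_(i <- s | P i) normc (f i).
Proof.
apply: (big_ind2 (fun z t => normc z <= t)) => //.
  by rewrite ComplexField.Normc.normc0.
by move=> a b c d ab cd; apply: le_trans (le_normcD _ _) (lerD ab cd).
Qed.

Lemma normc_nat m : normc m%:R = m%:R.
Proof. by rewrite normcMn ComplexField.Normc.normc1. Qed.

Lemma normc_ge0 z : 0 <= normc z.
Proof. by case: z => a b; apply: sqrtr_ge0. Qed.

(** Moduli and the triangle inequality in the eigenvalue equation, multiplied by [y i] and summed,
    show that the form at the vector of moduli is at least [normc l] times its weight. *)
Lemma eigenvalue_le_max (mu : R) (l : R[i]) :
  (forall y, (forall i, 0 <= y i) -> lap_form r E y <= mu * \sum_i y i ^+ r) ->
  tensor_eigenvalue (signless_laplacian R (r := r) E) l -> normc l <= mu.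
Proof.
move=> max_mu [x x0 xE]; pose y i := normc (x i 0).
have y0 i : 0 <= y i by apply: normc_ge0.
have s0 : 0 < \sum_i y i ^+ r.
  rewrite lt_neqAle eq_sym sumr_ge0 ?andbT; last by move=> i _; apply: exprn_ge0.
  apply: contra x0; rewrite psumr_eq0; last by move=> i _; apply: exprn_ge0.
  move=> /allP y_eq0; apply/eqP/colP => i; rewrite mxE.
  have := y_eq0 i (mem_index_enum _); rewrite expf_eq0 /= => /eqP.
  exact: ComplexField.Normc.eq0_normc.
rewrite -(ler_pM2r s0); apply: le_trans (max_mu y y0).
rewrite (lap_form_link _ uE) mulr_sumr; apply: ler_sum => i _.
have := congr1 (fun v : 'cV_n => v i 0) xE.
rewrite tensor_app_laplacian // !mxE => /(congr1 normc) eq_i.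
have : normc l * y i ^+ k.+1 <= (degree E i)%:R * y i ^+ k.+1 + link_sum E y i.
  rewrite /y -normcX -ComplexField.Normc.normcM -eq_i.
  apply: le_trans (le_normcD _ _) _.
  rewrite ComplexField.Normc.normcM normc_nat lerD2l.
  apply: le_trans (normc_sum _ _ _) _; apply: ler_sum => e _.
  by rewrite normc_prod.
move=> /(ler_wpM2l (y0 i)); rewrite /r mulrDr ![y i ^+ k.+2]exprS.
by rewrite ![y i * (_ * _)]mulrCA.
Qed.

Lemma eigenvalue_real (mu : R) (x : 'I_n -> R) :
  (exists i, x i != 0) ->
  (forall i, (mu - (degree E i)%:R) * x i ^+ k.+1 = link_sum E x i) ->
  tensor_eigenvalue (signless_laplacian R (r := r) E) (mu%:C)%C.
Proof.
move=> [i0 xi0] xE; exists (\col_i (x i)%:C%C).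
  apply: contra xi0 => /eqP/colP/(_ i0); rewrite !mxE => /complexI ->.
  by rewrite eqxx.
apply/colP => i; rewrite tensor_app_laplacian // !mxE.
have -> : link_sum E (fun j => (\col_i (x i)%:C%C) j 0) i = (link_sum E x i)%:C%C.
  rewrite /link_sum rmorph_sum; apply: eq_bigr => e _ /=.
  by rewrite rmorph_prod; apply: eq_bigr => j _; rewrite mxE.
rewrite -xE /= -rmorphXn /= -rmorphM /= -[(degree E i)%:R](rmorph_nat (real_complex R)).
by rewrite -rmorphM -rmorphD; congr (_ %:C)%C; ring.
Qed.

(** The maximum [mu] of the form bounds every eigenvalue in modulus and is itself an eigenvalue, so
    the supremum defining the spectral radius equals [mu]. *)
Lemma q_radius_eigenvector : (0 < n)%N -> exists x : 'I_n -> R,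
  [/\ forall i, 0 <= x i, \sum_i x i ^+ r = 1,
   forall i, (q_radius R r E - (degree E i)%:R) * x i ^+ k.+1 = link_sum E x i &
   forall y, (forall i, 0 <= y i) ->
      lap_form r E y <= q_radius R r E * \sum_i y i ^+ r].
Proof.
move=> n0; have [x [x0 x1 xmax]] := lap_form_maximizer R n0 uE.
pose mu := lap_form r E x.
have xE i := maximizer_eigen i x0 x1 (erefl mu) xmax.
have ub : ubound [set normc l | l in
    tensor_eigenvalue (signless_laplacian R (r := r) E)]%classic mu.
  by move=> _ [l lE <-]; apply: eigenvalue_le_max xmax lE.
have mu0 : 0 <= mu.
  apply: sumr_ge0 => e _; rewrite addr_ge0 ?mulr_ge0 ?prodr_ge0 //.
  by apply: sumr_ge0 => i _; rewrite exprn_ge0.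
have mu_in : [set normc l | l in
    tensor_eigenvalue (signless_laplacian R (r := r) E)]%classic mu.
  exists (mu%:C)%C; last by rewrite /= expr0n /= addr0 sqrtr_sqr ger0_norm.
  apply: eigenvalue_real xE; apply/existsP; rewrite -negb_forall.
  apply/negP => /forallP xz; move: x1; rewrite big1 => [/eqP|i _].
    by rewrite eq_sym oner_eq0.
  by rewrite (eqP (xz i)) expr0n.
have -> : q_radius R r E = mu; last by exists x.
apply/le_anti/andP; split.
  by apply: ge_sup => //; exists mu.
by apply: ub_le_sup => //; exists mu.
Qed.

Lemma q_radius_le : (0 < n)%N -> q_radius R r E <= 2 * 'C(n.-1, k.+1)%:R.
Proof.
move=> n0; have [x [x0 x1 xE xmax]] := q_radius_eigenvector n0.
have := lap_form_le (isT : (0 < r)%N) uE x0; rewrite x1 mulr1; apply: le_trans.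
rewrite (lap_form_link _ uE) -[leLHS]mulr1 -[in leLHS]x1 mulr_sumr.
by apply: ler_sum => i _; rewrite -xE /r [x i ^+ k.+2]exprS; lra.
Qed.

End Perron.

(** * Descent by vertex deletion *)

(** This is [removal_bound] in units of [M]. The 3 bounds [1 + (Q - 2 * D0)], as [Q <= 2] and
    [D0 >= 0]; the [n.+1] comes from [M <= K * n.+1]. *)
Lemma exists_removal (R : realType) (k n : nat) (E : hypergraph n.+1) (D : R) :
  (k.+1 < n)%N -> uniform k.+2 E ->
  let Q := q_radius R k.+2 E / 'C(n, k.+1)%:R in
  (min_degree E)%:R <= D * 'C(n, k.+1)%:R -> 1 <= Q -> 2 * D <= Q ->
  exists u, Q + (Q - 1) * (Q - 2 * D) / 3 / n.+1%:R
    <= q_radius R k.+2 (delete_vertex u E) / 'C(n.-1, k.+1)%:R.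
Proof.
move=> kn uE Q dD Q1 QD; have n0 : (0 < n)%N by apply: leq_trans kn.
have [x [x0 x1 xE _]] := q_radius_eigenvector R uE (ltn0Sn n).
have [v vd] := min_degree_attained E (ltn0Sn n).
case: (@arg_minP _ _ _ (ord0 : 'I_n.+1) predT x isT) => u _ umin.
exists u.
set q' := q_radius _ _ (delete_vertex u E).
set M : R := 'C(n, k.+1)%:R in Q dD Q1 QD *.
set K : R := 'C(n.-1, k)%:R.
have M0 : 0 < M by rewrite ltr0n bin_gt0 ltnW.
have M'E : 'C(n.-1, k.+1)%:R = M - K.
  by rewrite /M -{2}(prednK n0) binS natrD addrK.
have M'0 : 0 < M - K by rewrite -M'E ltr0n bin_gt0 -ltnS prednK.
have K0 : 0 <= K by rewrite ler0n.
have KM : M <= K * n.+1%:R.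
  have : n%:R * K = k.+1%:R * M by rewrite -!natrM mul_bin_diag.
  have : 1 <= k.+1%:R :> R by rewrite ler1n.
  rewrite -[n.+1%:R]natr1; nra.
have qE : q_radius R k.+2 E = Q * M by rewrite /Q divfK // gt_eqF.
(* [D0] is the degree of [v] in units of [M]; it is replaced by the larger [D] only in [step1]. *)
have [D0 dE] : exists D0, (degree E v)%:R = D0 * M.
  by exists ((degree E v)%:R / M); rewrite divfK // gt_eqF.
have D0_ge0 : 0 <= D0 by rewrite -(pmulr_lge0 _ M0) -dE ler0n.
have D0D : D0 <= D.
  by rewrite -(ler_pM2r M0) -dE; apply: le_trans dD; rewrite ler_nat.
have Q2 : Q <= 2.
  by rewrite /Q ler_pdivrMr //; apply: q_radius_le.
have h0 : 0 < 1 + (Q - 2 * D0) by lra.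
have denE : Q * M - 2 * (degree E v)%:R + M = M * (1 + (Q - 2 * D0)).
  by rewrite dE; ring.
have := @removal_bound R k n E x _ n0 uE x0 x1 xE u (fun i => umin i isT) q' v.
rewrite -/M -/K qE denE => bound.
have {}bound : Q * M - K - K * (Q - 1) / (1 + (Q - 2 * D0)) <= q'.
  have -> : K * (Q - 1) / (1 + (Q - 2 * D0))
      = K * (Q * M - M) / (M * (1 + (Q - 2 * D0))).
    by field; rewrite !gt_eqF.
  apply: bound.
  - by rewrite ler_peMl // ltW.
  - by rewrite mulr_gt0.
  - by have [y [_ _ _]] := q_radius_eigenvector R (delete_vertex_uniform u uE) n0.
rewrite M'E ler_pdivlMr //; apply: le_trans bound.
set h := Q - 2 * D0 in h0 *; set w := Q - 1.
have w0 : 0 <= w by rewrite subr_ge0.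
have hD : 0 <= Q - 2 * D <= h by rewrite /h; lra.
have h2 : h <= 2 by rewrite /h; lra.
have n1 : 0 < n.+1%:R :> R by rewrite ltr0n.
have step1 : w * (Q - 2 * D) / 3 / n.+1%:R * (M - K) <= w * h / 3 * K.
  apply: (@le_trans _ _ (w * h / 3 / n.+1%:R * M)).
    apply: ler_pM.
    - rewrite !divr_ge0 ?mulr_ge0 ?ler0n //; lra.
    - exact: ltW.
    - rewrite ler_pM2r ?invr_gt0 // ler_wpM2r ?invr_ge0 //.
      rewrite ler_wpM2l //; lra.
    - by rewrite gerBl.
  rewrite -!mulrA ler_wpM2l // ler_wpM2l //; first lra.
  rewrite ler_wpM2l // mulrC ler_pdivrMr //.
have step2 : w * h / 3 * K <= K * w - K * w / (1 + h).
  have -> : K * w - K * w / (1 + h) = w * h / (1 + h) * K.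
    by field; rewrite gt_eqF.
  rewrite ler_wpM2r // ler_wpM2l ?mulr_ge0 //; first lra.
  by rewrite lef_pV2 ?posrE //; lra.
have := le_trans step1 step2.
have -> : (Q + w * (Q - 2 * D) / 3 / n.+1%:R) * (M - K)
  = Q * (M - K) + w * (Q - 2 * D) / 3 / n.+1%:R * (M - K) by rewrite mulrDl.
set t1 := w * (Q - 2 * D) / 3 / _ * _; set t2 := K * w / _.
rewrite /w; nra.
Qed.

(** * Asymptotic estimates *)

Lemma fact_bin_le_exp (R : realFieldType) (n k : nat) :
  k`!%:R * 'C(n.-1, k)%:R <= n%:R ^+ k :> R.
Proof.
rewrite -natrM mulnC bin_ffact -natrX ler_nat.
elim: k => // k IH; rewrite ffactnSr expnSr leq_mul //.
by rewrite (leq_trans (leq_subr _ _)) ?leq_pred.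
Qed.

(** The falling factorial over [n^k] is a product of factors at most 1, so [A B >= A + B - 1] adds
    up their defects, and [k^2 + k + 1 <= (k + 1)^2] closes the induction. *)
Lemma exp_le_fact_bin (R : realFieldType) (n k : nat) :
  (1 - k%:R ^+ 2 / n%:R) * n%:R ^+ k <= k`!%:R * 'C(n.-1, k)%:R :> R.
Proof.
have [->|n_gt0] := posnP n.
  by case: k => [|k]; rewrite ?expr0n /= ?mulr0 ?mul0r ?subr0 ?ler0n ?mulr1 ?mul1r.
rewrite -natrM mulnC bin_ffact.
have n0 : 0 < n%:R :> R by rewrite ltr0n.
elim: k => [|k IH]; first by rewrite expr0n /= mul0r subr0 mulr1.
set A : R := (n.-1 ^_ k)%:R / n%:R ^+ k.
set B : R := (n.-1 - k)%:R / n%:R.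
have nk0 : 0 < n%:R ^+ k :> R by rewrite exprn_gt0.
have A_le1 : A <= 1.
  rewrite ler_pdivrMr // mul1r; have := fact_bin_le_exp R n k.
  by rewrite -natrM mulnC bin_ffact.
have A_ge : 1 - k%:R ^+ 2 / n%:R <= A by rewrite ler_pdivlMr.
have B_le1 : B <= 1.
  rewrite ler_pdivrMr // mul1r ler_nat.
  by rewrite (leq_trans (leq_subr _ _)) ?leq_pred.
have B_ge : 1 - k.+1%:R / n%:R <= B.
  rewrite /B ler_pdivlMr // mulrBl divfK ?gt_eqF // mul1r.
  by rewrite lerBlDr -natrD ler_nat; lia.
have -> : (n.-1 ^_ k.+1)%:R = A * B * n%:R ^+ k.+1 :> R.
  rewrite ffactnSr natrM /A /B exprS; field.
  by rewrite ?gt_eqF.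
rewrite ler_pM2r ?exprn_gt0 //.
have : (k%:R ^+ 2 + k.+1%:R) / n%:R <= k.+1%:R ^+ 2 / n%:R :> R.
  rewrite ler_pM2r ?invr_gt0 // -!natrX -natrD ler_nat; lia.
rewrite mulrDl; nra.
Qed.

Lemma harmonic_unbounded (R : realType) (B : R) :
  exists2 N, (0 < N)%N & forall n, (N <= n)%N -> B < series harmonic n.
Proof.
have incr : {homo series (@harmonic R) : m n / (m <= n)%N >-> m <= n}.
  move=> m n mn; rewrite -subr_ge0 sub_series_geq //.
  by apply: sumr_ge0 => i _; rewrite /= invr_ge0 ler0n.
have /cvgryPgt /(_ B) [N _ NB] := nondecreasing_dvgn_lt incr (@dvg_harmonic R).
by exists N.+1 => // n /ltnW; apply: NB.
Qed.

(* [lim] of a divergent sequence is the default point 0, so a nonzero Turan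
   density already carries the convergence. *)
Lemma turan_density_cvg (R : realType) (r : nat) (F : hypergraph_family) :
  turan_density R r F != 0 ->
  (((turan_number r F n)%:R / 'C(n, r)%:R : R) @[n --> \oo]
    --> turan_density R r F)%classic.
Proof.
move=> pi0; apply: contrapT => ncvg; move/eqP: pi0; apply.
by rewrite /turan_density dvgP.
Qed.

Lemma q_radius_max_ge (R : realType) (r n : nat) (S : {set hypergraph n})
    (E : hypergraph n) :
  E \in S -> q_radius R r E <= q_radius_max R r S.
Proof. by move=> ES; apply: le_bigmax_cond. Qed.

Lemma exp_le_fact_bin_near (R : realType) (k : nat) (eta : R) : 0 < eta ->
  \forall n \near \oo%classic,
    n%:R ^+ k <= (1 + eta) * (k`!%:R * 'C(n.-1, k)%:R).
Proof.
(* From this threshold on, [(1 + eta) k^2 / n <= eta], which offsets the loss in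
   [exp_le_fact_bin]. *)
move=> eta0; pose y : R := k%:R ^+ 2 * (1 + eta) / eta.
have y0 : 0 <= y by rewrite divr_ge0 ?mulr_ge0 ?exprn_ge0 //; lra.
exists (Num.bound y).+1 => // n /= yn.
have n0 : 0 < n%:R :> R by rewrite ltr0n; lia.
have {}yn : y <= n%:R.
  apply/ltW/(lt_le_trans (archi_boundP y0)); rewrite ler_nat; lia.
have small : 1 <= (1 + eta) * (1 - k%:R ^+ 2 / n%:R).
  move: yn; rewrite ler_pdivrMr // => yn.
  have : (1 + eta) * (k%:R ^+ 2 / n%:R) <= eta.
    by rewrite mulrA ler_pdivrMr // mulrC [eta * _]mulrC.
  lra.
apply: (@le_trans _ _ ((1 + eta) * (1 - k%:R ^+ 2 / n%:R) * n%:R ^+ k)).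
  by rewrite ler_peMl // exprn_ge0.
by rewrite -mulrA ler_wpM2l ?exp_le_fact_bin //; lra.
Qed.

Lemma div_nat_near (R : realType) (a b : R) : 0 < b ->
  \forall n \near \oo%classic, a / n%:R <= b.
Proof.
move=> b0; exists (Num.bound (`|a| / b)).+1 => // n /= yn.
have n0 : 0 < n%:R :> R by rewrite ltr0n; lia.
rewrite ler_pdivrMr // mulrC -ler_pdivrMr //.
apply: (@le_trans _ _ (`|a| / b)); first by rewrite ler_pM2r ?invr_gt0 ?ler_norm.
apply/ltW; apply: (lt_le_trans (archi_boundP _)).
  by rewrite divr_ge0 // ltW.
by rewrite ler_nat; lia.
Qed.

(** With [tau = 2 pi - 1], the tolerances give [Q - 1 >= tau / 2] and [Q - 2 D >= eps], whence the
    constant [tau eps / 6]. *)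
Lemma removal_gain_arith (R : realFieldType) (pi eps Q e t : R) :
  0 < 2 * pi - 1 -> 0 < eps -> pi - eps / 8 <= e ->
  pi - (2 * pi - 1) / 8 <= e -> t <= eps / 4 -> t <= (2 * pi - 1) / 4 ->
  - t <= Q - 2 * e ->
  let D := pi - 3 / 4 * eps in
  [/\ 1 <= Q, 2 * D <= Q &
      (2 * pi - 1) * eps / 6 <= (Q - 1) * (Q - 2 * D) / 3].
Proof.
move=> tau0 eps0 e1 e2 t1 t2 Qe; split; [lra|lra|].
have : (2 * pi - 1) / 2 * eps <= (Q - 1) * (Q - 2 * (pi - 3 / 4 * eps)).
  by apply: ler_pM; lra.
lra.
Qed.

Lemma double_leq_bounds (k n : nat) : (k.+2 * 2 <= n)%N ->
  [/\ (0 < n)%N, (k.+2 <= n)%N & (k.+1 < n.-1)%N].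
Proof. by move=> kn; split; lia. Qed.

(** * Iterated deletion for a fixed family *)

Section Descent.
Variables (R : realType) (k : nat) (F : hypergraph_family).
Let r := k.+2.
Let f : R := k.+1`!%:R.
Let pi : R := turan_density R r F.
Let T (n : nat) : R := (turan_number r F n)%:R.
Let e (n : nat) : R := T n / 'C(n, r)%:R.
Let M (n : nat) : R := 'C(n.-1, k.+1)%:R.
Let Q n (E : hypergraph n) : R := q_radius R r E / M n.

Let f_ge1 : 1 <= f. Proof. by rewrite ler1n fact_gt0. Qed.
Let f_gt0 : 0 < f. Proof. by rewrite ltr0n fact_gt0. Qed.

(** By Pascal's rule ['C(n, r)] grows by [M n], while [T] grows by at least about [pi * M n]; hence
    [e] can be larger at [n.-1] only by a multiple of [sigma / n]. *)
Lemma turan_ratio_drop (sigma : R) (n : nat) : 0 <= sigma ->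
  (r * 2 <= n)%N -> e n <= pi + sigma ->
  n%:R ^+ k.+1 <= 2 * (f * M n) ->
  pi / f * n%:R ^+ k.+1 - sigma * n%:R ^+ k.+1 <= T n - T n.-1 ->
  0 <= pi ->
  e n.-1 - e n <= 6 * r`!%:R * sigma / n%:R.
Proof.
move=> s0 rn en nM TT pi0.
case: n rn en nM TT => // p rn en nM; rewrite -[p.+1.-1]/p => TT.
set C : R := 'C(p, r)%:R.
have C0 : 0 < C by rewrite ltr0n bin_gt0; lia.
have Cn : 'C(p.+1, r)%:R = C + M p.+1 by rewrite /C /M -natrD binS.
have Mp0 : 0 <= M p.+1 by rewrite ler0n.
have TE : T p.+1 = e p.+1 * (C + M p.+1).
  by rewrite /e Cn divfK // gt_eqF //; lra.
have T'E : T p = e p * C by rewrite /e divfK // gt_eqF.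
have Mn : pi * M p.+1 <= pi / f * p.+1%:R ^+ k.+1.
  rewrite -mulrA ler_wpM2l // mulrC ler_pdivlMr //.
  by rewrite mulrC; apply: fact_bin_le_exp R p.+1 k.+1.
(* Two of the three multiples of [f * sigma * M] come from the term [sigma n^(r-1)], the third from
   [e n <= pi + sigma]. *)
have drop : (e p - e p.+1) * C <= 3 * f * sigma * M p.+1.
  have : sigma * p.+1%:R ^+ k.+1 <= sigma * (2 * (f * M p.+1)) by rewrite ler_wpM2l.
  have : (e p.+1 - pi) * M p.+1 <= sigma * M p.+1 by rewrite ler_wpM2r //; lra.
  have : sigma * M p.+1 <= f * (sigma * M p.+1) by rewrite ler_peMl // mulr_ge0.
  by move: TT; rewrite TE T'E; lra.
(* Since [p.+1] is at least [2 r], the factor [p - k.+1] is at least half of [p.+1]. *)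
have MC : M p.+1 * p.+1%:R <= 2 * r%:R * C.
  rewrite /M /C -!natrM ler_nat /= -mulnA mul_bin_left.
  have : (p.+1 <= 2 * (p - k.+1))%N by rewrite /r in rn; lia.
  by nia.
rewrite ler_pdivlMr ?ltr0n // -(ler_pM2r C0) mulrAC.
have fr : r`!%:R = r%:R * f :> R by rewrite -natrM -factS.
apply: (@le_trans _ _ (3 * f * sigma * M p.+1 * p.+1%:R)).
  by rewrite ler_wpM2r.
rewrite fr -mulrA.
have -> : 6 * (r%:R * f) * sigma * C = 3 * f * sigma * (2 * r%:R * C) by ring.
by rewrite ler_wpM2l // !mulr_ge0 //; lra.
Qed.

Variables (eps sigma : R) (m0 : nat).
Let tau := 2 * pi - 1.
(** [c / n] is the gain in [Q] from one deletion, and [s / n] the error of near-extremality in units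
    of [M n]. *)
Let c := tau * eps / 6.
Let s := 2 * f * sigma.

Hypothesis eps_gt0 : 0 < eps.
Hypothesis tau_gt0 : 0 < tau.
Hypothesis sigma_gt0 : 0 < sigma.
Hypothesis sigma_small : 24 * r`!%:R * sigma < c.
Hypothesis m0_large : (r * 2 <= m0)%N.
Hypothesis ratio_le : forall n, (m0 <= n)%N -> e n <= pi + sigma.
Hypothesis ratio_ge_eps : forall n, (m0 <= n)%N -> pi - eps / 8 <= e n.
Hypothesis ratio_ge_tau : forall n, (m0 <= n)%N -> pi - tau / 8 <= e n.
Hypothesis exp_le2 : forall n, (m0 <= n)%N -> n%:R ^+ k.+1 <= 2 * (f * M n).
Hypothesis exp_le_eps : forall n, (m0 <= n)%N ->
  pi * n%:R ^+ k.+1 <= (pi + eps / 4) * (f * M n).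
Hypothesis s_le_eps : forall n, (m0 <= n)%N -> s / n%:R <= eps / 4.
Hypothesis s_le_tau : forall n, (m0 <= n)%N -> s / n%:R <= tau / 4.
Hypothesis turan_step : forall n, (m0 < n)%N ->
  pi / f * n%:R ^+ k.+1 - sigma * n%:R ^+ k.+1 <= T n - T n.-1.
Hypothesis q_max_near : forall n, (m0 <= n)%N ->
  `|q_radius_max R r (dense_free r n F eps) - 2 * r%:R * (T n / n%:R)|
    <= sigma * n%:R ^+ k.

Let n_large n : (m0 <= n)%N -> (k.+2 * 2 <= n)%N.
Proof. exact: leq_trans. Qed.

Let pred_large p : (m0 <= p.+1)%N -> (k.+1 < p)%N.
Proof. by move=> mn; have [] := double_leq_bounds (n_large mn). Qed.

Let M_gt0 n : (m0 <= n)%N -> 0 < M n.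
Proof.
by move=> mn; have [_ _ kn] := double_leq_bounds (n_large mn); rewrite ltr0n bin_gt0 ltnW.
Qed.

Let n_gt0 n : (m0 <= n)%N -> 0 < n%:R :> R.
Proof. by move=> mn; have [n0 _ _] := double_leq_bounds (n_large mn); rewrite ltr0n. Qed.

(** Since [n * M n = r * 'C(n, r)], division by [M n] turns [r T(n) / n] into [e n]; [exp_le2] turns
    the error [sigma n^(r-2)] into [s / n]. *)
Lemma q_max_ratio n : (m0 <= n)%N ->
  `|q_radius_max R r (dense_free r n F eps) / M n - 2 * e n| <= s / n%:R.
Proof.
move=> mn; have Mn := M_gt0 mn; have n0 := n_gt0 mn.
have nM : n%:R * M n = r%:R * 'C(n, r)%:R by rewrite -!natrM mul_bin_diag.
have C0 : 0 < 'C(n, r)%:R :> R.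
  by have [_ kn _] := double_leq_bounds (n_large mn); rewrite ltr0n bin_gt0.
have -> : 2 * e n = 2 * r%:R * (T n / n%:R) / M n.
  have -> : 2 * r%:R * (T n / n%:R) / M n = 2 * r%:R * T n / (n%:R * M n).
    by field; rewrite !gt_eqF.
  have : r%:R != 0 :> R by rewrite pnatr_eq0.
  rewrite nM /e; move: (r%:R : R) => rho rho0; field.
  by rewrite rho0 gt_eqF.
rewrite -mulrBl normrM normfV (gtr0_norm Mn) ler_pdivrMr //.
apply: (le_trans (q_max_near mn)); rewrite mulrAC ler_pdivlMr //.
rewrite -mulrA -exprSr /s; have := exp_le2 mn.
by move=> /(ler_wpM2l (ltW sigma_gt0)); lra.
Qed.

(** Passing from [n^(r-1)] to [M n] costs [eps / 4] in the main term, while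
    [n^(r-1) >= f M n >= M n] keeps the full [eps] in the subtracted one. *)
Lemma degree_threshold n : (m0 <= n)%N ->
  (pi / f - eps) * n%:R ^+ k.+1 <= (pi - 3 / 4 * eps) * M n.
Proof.
move=> mn; have Mn := M_gt0 mn.
have : pi / f * n%:R ^+ k.+1 <= (pi + eps / 4) * M n.
  rewrite mulrAC ler_pdivrMr // -mulrA [M n * f]mulrC; exact: exp_le_eps.
have : eps * M n <= eps * n%:R ^+ k.+1.
  rewrite ler_pM2l //; apply: le_trans (fact_bin_le_exp R n k.+1).
  by rewrite ler_peMl // ltW.
by lra.
Qed.

(** Deletion raises [Q] by at least [c / n] and [2 e] by at most half of that, so half of the gain
    survives. *)
Lemma removal_gain n (E : hypergraph n) : (m0 < n)%N ->
  uniform r E -> family_free F E -> E \notin dense_free r n F eps ->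
  - (s / n%:R) <= Q E - 2 * e n ->
  exists E' : hypergraph n.-1, [/\ uniform r E', family_free F E' &
    Q E - 2 * e n + c / 2 / n%:R <= Q E' - 2 * e n.-1].
Proof.
case: n E => // p E mp uE fE Edense fEn.
have mn : (m0 <= p.+1)%N by apply: ltnW.
have n0 := n_gt0 mn; have Mn := M_gt0 mn.
have degE : (min_degree E)%:R <= (pi - 3 / 4 * eps) * M p.+1.
  apply: le_trans (degree_threshold mn).
  move: Edense; rewrite inE uE (introT (asboolP _) fE) /=.
  by rewrite -leNgt.
have [Q1 Q2 c_le] := removal_gain_arith tau_gt0 eps_gt0 (ratio_ge_eps mn)
  (ratio_ge_tau mn) (s_le_eps mn) (s_le_tau mn) fEn.
have kp := pred_large mn.
have [u gain] := exists_removal kp uE degE Q1 Q2.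
exists (delete_vertex u E); split.
- exact: delete_vertex_uniform.
- exact: delete_vertex_free.
have pi0 : 0 <= pi by have := tau_gt0; rewrite /tau; lra.
have rp : (r * 2 <= p.+1)%N by apply: n_large.
have drop := turan_ratio_drop (ltW sigma_gt0) rp (ratio_le mn) (exp_le2 mn)
  (turan_step mp) pi0.
have {}c_le : c / p.+1%:R
    <= (Q E - 1) * (Q E - 2 * (pi - 3 / 4 * eps)) / 3 / p.+1%:R.
  by rewrite ler_pM2r ?invr_gt0.
(* Twice the bound [6 r! sigma / n] must be at most [c / 2 / n]; this is the source of the 24 in
   [sigma_small]. *)
have {}drop : 2 * (e p - e p.+1) <= c / 2 / p.+1%:R.
  apply: le_trans (ler_wpM2l (ler0n _ 2) drop) _.
  rewrite mulrA ler_pM2r ?invr_gt0 // ler_pdivlMr //.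
  rewrite (le_trans _ (ltW sigma_small)) // le_eqVlt; apply/orP; left.
  by apply/eqP; ring.
have cE : c / p.+1%:R = c / 2 / p.+1%:R + c / 2 / p.+1%:R.
  by rewrite -mulrDl -splitr.
have {}gain : Q E + c / p.+1%:R <= Q (delete_vertex u E).
  by apply: le_trans gain; rewrite lerD2l.
move: drop gain; rewrite cE -[p.+1.-1]/p.
move: (Q E) (Q _) (e p) (e p.+1) (c / 2 / p.+1%:R) => *; lra.
Qed.

(** One deletion has to lift the excess [Q - 2 e] from [- s / n] past [s / (n - 1) <= 2 s / n],
    which takes [3 s < c / 2]. *)
Let six_s_lt_c : 6 * s < c.
Proof.
apply: le_lt_trans sigma_small.
have fr : r`!%:R = r%:R * f :> R by rewrite -natrM -factS.
rewrite fr /s; have -> : 6 * (2 * f * sigma) = 12 * (f * sigma) by ring.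
have -> : 24 * (r%:R * f) * sigma = 24 * r%:R * (f * sigma) by ring.
rewrite ler_pM2r ?mulr_gt0 //.
by rewrite -natrM ler_nat; lia.
Qed.

(** Used contrapositively: an excess above [s / n] excludes membership in the dense class. *)
Lemma dense_deficiency n (E : hypergraph n) : (m0 <= n)%N ->
  E \in dense_free r n F eps -> Q E - 2 * e n <= s / n%:R.
Proof.
move=> mn EH; have := q_max_ratio mn; rewrite ler_norml => /andP[_].
apply: le_trans; rewrite lerD2r ler_pM2r ?invr_gt0 ?M_gt0 //.
exact: q_radius_max_ge.
Qed.

(** Each deletion adds [c / 2 / n] to the excess, a multiple of a harmonic term, and lifts it too
    high for the dense class, so the induction hypothesis applies to the smaller graph. *)
Lemma deficiency_bound n (E : hypergraph n) : (m0 <= n)%N ->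
  uniform r E -> family_free F E -> E \notin dense_free r n F eps ->
  - (s / n%:R) <= Q E - 2 * e n ->
  Q E - 2 * e n + c / 2 * (series harmonic n - series harmonic m0) <= 2.
Proof.
elim: n E => [|p IH] E mn uE fE Edense fEn; first by have := n_large mn.
(* At the bottom, [p.+1 = m0], the harmonic sum is empty and [Q <= 2] suffices. *)
have [m0p|pm0] := leqP m0 p; last first.
  have -> : m0 = p.+1 by apply/eqP; rewrite eqn_leq mn.
  rewrite subrr mulr0 addr0 lerBlDr ler_wpDr ?mulr_ge0 ?divr_ge0 //.
  by rewrite ler_pdivrMr ?M_gt0 //; apply: q_radius_le.
have [E' [uE' fE' gain]] :=
  removal_gain (m0p : (m0 < p.+1)%N) uE fE Edense fEn.
have p0 := n_gt0 m0p; have p1 := n_gt0 mn.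
have s0 : 0 <= s by rewrite !mulr_ge0 // ltW.
have s_p : s / p%:R <= 2 * s / p.+1%:R.
  have -> : 2 * s / p.+1%:R = s * (2 / p.+1%:R) by ring.
  rewrite ler_wpM2l // ler_pdivlMr // mulrC ler_pdivrMr //.
  rewrite -natrM ler_nat mul2n -addnn -add1n leq_add2r.
  exact: leq_trans (n_large m0p).
have s_c : 2 * s / p.+1%:R + s / p.+1%:R < c / 2 / p.+1%:R.
  by rewrite -mulrDl ltr_pM2r ?invr_gt0 //; have := six_s_lt_c; move: (s) (c) => *; lra.
have sp0 : 0 <= s / p%:R by rewrite divr_ge0 // ltW.
have E'large : s / p%:R < Q E' - 2 * e p.
  apply: lt_le_trans gain; move: fEn s_c s_p.
  move: (Q E - _) (s / p%:R) (2 * s / _) (s / _) (c / 2 / _) => *; lra.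
have E'dense : E' \notin dense_free r p F eps.
  by apply/negP => /(dense_deficiency m0p); rewrite leNgt E'large.
have E'ge : - (s / p%:R) <= Q E' - 2 * e p.
  by apply: le_trans (ltW E'large); rewrite -subr_ge0 opprK addr_ge0.
apply: le_trans (IH E' m0p uE' fE' E'dense E'ge).
(* [harmonic] is indexed from 0, so the last term of [series harmonic p.+1] is [1 / p.+1]. *)
have -> : c / 2 * (series harmonic p.+1 - series harmonic m0)
    = c / 2 / p.+1%:R + c / 2 * (series harmonic p - series harmonic m0).
  by rewrite /series /= big_nat_recr //=; ring.
by rewrite addrA lerD2r.
Qed.

End Descent.

(** * Choice of constants and conclusion *)

Unset Implicit Arguments.

Theorem theorem2p1 (R : realType) (r : nat) (F : hypergraph_family) :
  (2 <= r)%N -> uniform_family r F -> 1 / 2 < turan_density R r F ->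
  exists2 eps0 : R, 0 < eps0 & forall eps : R, 0 < eps < eps0 ->
  exists2 sigma0 : R, 0 < sigma0 & forall sigma : R, 0 < sigma < sigma0 ->
  (exists2 N : nat, (0 < N)%N & forall n : nat, (N < n)%N ->
     `|(turan_number r F n)%:R - (turan_number r F n.-1)%:R
        - turan_density R r F / (r.-1)`!%:R * n%:R ^+ r.-1|
       <= sigma * n%:R ^+ r.-1
     /\
     `|q_radius_max R r (dense_free r n F eps)
        - 2 * r%:R * ((turan_number r F n)%:R / n%:R)|
       <= sigma * n%:R ^+ (r - 2)) ->
  exists2 n0 : nat, (0 < n0)%N & forall (n : nat) (G : hypergraph n),
    (n0 <= n)%N -> uniform r G -> family_free F G ->
    q_radius R r G <= q_radius_max R r (dense_free r n F eps)
    /\ (q_radius R r G = q_radius_max R r (dense_free r n F eps) ->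
        G \in dense_free r n F eps).
Proof.
case: r => [|[|k]] // _ _.
set pi := turan_density R k.+2 F => pi_gt; have tau0 : 0 < 2 * pi - 1 by lra.
(* The smallness that matters is that of [sigma] against [eps]; 1 is a convenient value. *)
exists 1 => // eps /andP[eps0 _].
set c := (2 * pi - 1) * eps / 6.
have c0 : 0 < c by rewrite !mulr_gt0 // invr_gt0.
have fact0 : 0 < 24 * k.+2`!%:R :> R by rewrite mulr_gt0 // ltr0n fact_gt0.
(* This value makes [sigma < sigma0] the hypothesis [sigma_small] of the descent. *)
exists (c / (24 * k.+2`!%:R)); first by rewrite divr_gt0.
move=> sigma /andP[sigma0]; rewrite ltr_pdivlMr // mulrC => sigma_small [N _ HN].
set s := 2 * k.+1`!%:R * sigma.
have pi0 : 0 < pi by lra.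
have pi_ne0 : turan_density R k.+2 F != 0 by rewrite gt_eqF.
(* One tolerance for the three required estimates of the Turán ratio around [pi]. *)
pose eta := Order.min sigma (Order.min (eps / 8) ((2 * pi - 1) / 8)).
have eta0 : 0 < eta by rewrite !lt_min sigma0 !divr_gt0.
have /cvgrPdist_le /(_ _ eta0) near_ratio := turan_density_cvg pi_ne0.
(* The relative error for which [pi (1 + eps / (4 pi)) = pi + eps / 4]. *)
have eps_pi : 0 < eps / (4 * pi) by rewrite divr_gt0 // mulr_gt0.
have near_exp2 := exp_le_fact_bin_near k.+1 (ltr01 : 0 < 1 :> R).
have near_exp := exp_le_fact_bin_near k.+1 eps_pi.
have near_eps := div_nat_near s (divr_gt0 eps0 (ltr0n R 4 : 0 < 4)).
have near_tau := div_nat_near s (divr_gt0 tau0 (ltr0n R 4 : 0 < 4)).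
have [m0 _ Hm0] := filterI near_ratio (filterI near_exp2 (filterI near_exp
  (filterI near_eps (filterI near_tau (nbhs_infty_ge (N.+1 + k.+2 * 2)))))).
(* Past [n0] the descent to [m0] gains more than [2 + eps / 4], where [eps / 4] covers a starting
   excess as low as [- s / n]. *)
have [n0 n0_gt0 Hn0] := harmonic_unbounded
  (series harmonic m0 + 2 / c * (2 + eps / 4)).
exists (maxn m0 n0) => [|n G]; first by rewrite leq_max n0_gt0 orbT.
rewrite geq_max => /andP[mn nn] uG fG.
(* Strict inequality outside the dense class yields both the bound and the equality case. *)
suff bad : G \notin dense_free k.+2 n F eps ->
    q_radius R k.+2 G < q_radius_max R k.+2 (dense_free k.+2 n F eps).
  have [GH|/bad q_lt] := boolP (G \in dense_free k.+2 n F eps).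
    by split => //; apply: q_radius_max_ge.
  by split; [exact: ltW|move=> q_eq; rewrite q_eq ltxx in q_lt].
move=> Gdense; rewrite ltNge; apply/negP => q_ge.
have ratio m : (m0 <= m)%N ->
    `|pi - (turan_number k.+2 F m)%:R / 'C(m, k.+2)%:R| <= eta.
  by move=> /Hm0 [].
have large m : (m0 <= m)%N -> (N.+1 + k.+2 * 2 <= m)%N.
  by move=> /Hm0 [_ [_ [_ [_ [_]]]]].
have HN' m : (m0 <= m)%N -> (N < m)%N.
  by move=> /large; apply: leq_trans; rewrite ltn_addr.
have m0_large : (k.+2 * 2 <= m0)%N.
  by apply: leq_trans (large _ (leqnn m0)); rewrite leq_addl.
have ratio_le m : (m0 <= m)%N ->
    (turan_number k.+2 F m)%:R / 'C(m, k.+2)%:R <= pi + sigma.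
  by move=> /ratio; rewrite /eta !le_min ler_distlC => /andP[/andP[]].
have ratio_ge b : eta <= b -> forall m, (m0 <= m)%N ->
    pi - b <= (turan_number k.+2 F m)%:R / 'C(m, k.+2)%:R.
  by move=> eta_b m /ratio /le_trans /(_ eta_b); rewrite ler_distlC => /andP[].
have exp_le2 m : (m0 <= m)%N ->
    m%:R ^+ k.+1 <= 2 * (k.+1`!%:R * 'C(m.-1, k.+1)%:R) :> R.
  by move=> /Hm0 [_ []].
have exp_le_eps m : (m0 <= m)%N -> pi * m%:R ^+ k.+1
    <= (pi + eps / 4) * (k.+1`!%:R * 'C(m.-1, k.+1)%:R).
  move=> /Hm0 [_ [_ [H _]]].
  have -> : pi + eps / 4 = pi * (1 + eps / (4 * pi)).
    by field; rewrite gt_eqF.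
  by rewrite -mulrA ler_wpM2l // ltW.
have s_le_eps m : (m0 <= m)%N -> s / m%:R <= eps / 4 by move=> /Hm0 [_ [_ [_ []]]].
have s_le_tau m : (m0 <= m)%N -> s / m%:R <= (2 * pi - 1) / 4.
  by move=> /Hm0 [_ [_ [_ [_ []]]]].
have turan_step m : (m0 < m)%N ->
    pi / k.+1`!%:R * m%:R ^+ k.+1 - sigma * m%:R ^+ k.+1
      <= (turan_number k.+2 F m)%:R - (turan_number k.+2 F m.-1)%:R.
  by move=> /ltnW /HN' /HN [H _]; move: H; rewrite ler_distl => /andP[].
have q_near m : (m0 <= m)%N ->
    `|q_radius_max R k.+2 (dense_free k.+2 m F eps)
      - 2 * k.+2%:R * ((turan_number k.+2 F m)%:R / m%:R)| <= sigma * m%:R ^+ k.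
  by move=> /HN' /HN [_]; rewrite subSS subSS subn0.
have eta_eps : eta <= eps / 8 by rewrite !ge_min lexx orbT.
have eta_tau : eta <= (2 * pi - 1) / 8 by rewrite !ge_min lexx !orbT.
have M0 : 0 < 'C(n.-1, k.+1)%:R :> R.
  have [_ _ kn] := double_leq_bounds (leq_trans m0_large mn).
  by rewrite ltr0n bin_gt0 ltnW.
(* The assumed [q(G) >= q(H_n)] passes the lower estimate of [q_max_ratio] on to [G]. *)
have Q_ge : - (s / n%:R) <= q_radius R k.+2 G / 'C(n.-1, k.+1)%:R
    - 2 * ((turan_number k.+2 F n)%:R / 'C(n, k.+2)%:R).
  have := q_max_ratio sigma0 m0_large exp_le2 q_near mn.
  rewrite ler_norml => /andP[H _]; apply: le_trans H _.
  by rewrite lerD2r ler_pM2r ?invr_gt0.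
have := deficiency_bound eps0 tau0 sigma0 sigma_small m0_large ratio_le
  (ratio_ge _ eta_eps) (ratio_ge _ eta_tau) exp_le2 exp_le_eps s_le_eps s_le_tau
  turan_step q_near mn uG fG Gdense Q_ge.
rewrite -/c; apply/negP; rewrite -ltNge.
have h_large : 2 + eps / 4 < c / 2 * (series harmonic n - series harmonic m0).
  have := Hn0 n nn; rewrite -ltrBrDl -[2 / c]invf_div => H.
  by rewrite -(ltr_pdivrMl _ _ (divr_gt0 c0 (ltr0n R 2 : 0 < 2))).
have s_n := s_le_eps _ mn.
move: Q_ge h_large s_n; rewrite -/s.
move: (s / n%:R) (_ - _) (c / 2 * _) => a b d; lra.
Qed.
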